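(* For all integers $m\ge 0$ and $k\ge 1$ and all $x\in\mathbb{C}$, $$\sum_{n=0}^{m}\frac{\binom{m}{n}}{\binom{n+k}{n}}S_2(n+k,k)(-x)^{m-n}=\sum_{n=0}^{m}C_n^{(k)}(x)\,S_2(m,n).$$
   Context: $(x)_n = x(x-1)\cdots(x-n+1)$ denotes the falling factorial, with $(x)_0=1$. For integers $k\ge1$, $n\ge0$, the higher-order Cauchy polynomials of the first kind (of order $k$) are $$C_n^{(k)}(x)=\int_0^1\cdots\int_0^1 (x_1+\cdots+x_k-x)_n\,dx_1\cdots dx_k.$$ $S_2(l,n)$ are the Stirling numbers of the second kind, defined by $(e^t-1)^n=n!\sum_{l=n}^\infty S_2(l,n)\frac{t^l}{l!}$. Convention: $0^0=1$. *)

(* Defs.v *)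
(* Stdlib reals with Coquelicot. *)
From Stdlib Require Import Reals Lra Lia List.
From Coquelicot Require Import Coquelicot.
Local Open Scope R_scope.

Fixpoint falling_factorial (z : C) (n : nat) : C :=
  match n with
  | O => RtoC 1
  | S p => Cmult (falling_factorial z p) (Cminus z (RtoC (INR p)))
  end.

(* [unit_cube_int k f] is the iterated integral
   int_0^1 ... int_0^1 f [x_1; ...; x_k] dx_1 ... dx_k,
   with dx_1 innermost, of a complex-valued function of k real variables. *)
Fixpoint unit_cube_int (k : nat) (f : list R -> C) : C :=
  match k with
  | O => f nil
  | S p =>
      unit_cube_int p
        (fun xs => RInt (V := C_R_CompleteNormedModule)
                        (fun t => f (t :: xs)) 0 1)
  end.

Definition list_sum_R (xs : list R) : R := fold_right Rplus 0 xs.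

Definition cauchy_poly (k n : nat) (x : C) : C :=
  unit_cube_int k
    (fun xs => falling_factorial (Cminus (RtoC (list_sum_R xs)) x) n).

(* Coefficients of the power series of e^t - 1, and of its n-th power. *)
Definition expm1_coef (j : nat) : R :=
  match j with O => 0 | S _ => / INR (Factorial.fact j) end.

Fixpoint expm1_pow_coef (n : nat) : nat -> R :=
  match n with
  | O => fun l => match l with O => 1 | S _ => 0 end
  | S p => PS_mult expm1_coef (expm1_pow_coef p)
  end.

(* Read off from (e^t - 1)^n = n! sum_{l >= n} S_2(l,n) t^l / l! ;
   see [stirling2_generating_function] and [stirling2_eq0]. *)
Definition stirling2 (l n : nat) : R :=
  INR (Factorial.fact l) / INR (Factorial.fact n) * expm1_pow_coef n l.

Lemma expm1_pow_coef_eq0 n l : (l < n)%nat -> expm1_pow_coef n l = 0.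
Proof.
revert l; induction n as [|n IH]; intros l Hl; [lia|].
simpl; unfold PS_mult.
rewrite (sum_eq _ (fun _ => 0) l).
- rewrite sum_cte; ring.
- intros [|i] Hi; simpl expm1_coef; [ring|].
  rewrite IH by lia; ring.
Qed.

Lemma stirling2_eq0 l n : (l < n)%nat -> stirling2 l n = 0.
Proof.
intros H; unfold stirling2; rewrite expm1_pow_coef_eq0 by exact H; ring.
Qed.

Lemma CV_radius_entire (a : nat -> R) (t : R) :
  (forall x, ex_pseries a x) -> Rbar_lt (Rabs t) (CV_radius a).
Proof.
intros Ha.
apply Rbar_lt_le_trans with (Finite (Rabs t + 1)); [simpl; lra|].
apply Rbar_not_lt_le; intros H.
assert (Hp : 0 <= Rabs t + 1) by (generalize (Rabs_pos t); lra).
apply (CV_disk_outside a (Rabs t + 1)).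
- now rewrite (Rabs_pos_eq _ Hp).
- apply ex_series_lim_0.
  destruct (Ha (Rabs t + 1)) as [s Hs]; exists s.
  now apply is_pseries_R.
Qed.

Lemma is_pseries_expm1 t : is_pseries expm1_coef t (exp t - 1).
Proof.
assert (H1 : is_pseries (fun n => / INR (Factorial.fact (S n))) t
               (if Req_EM_T t 0 then 1 else / t * (exp t - 1))).
{ destruct (Req_EM_T t 0) as [->|Ht].
  - generalize (is_pseries_0 (V := R_NormedModule)
                  (fun n => / INR (Factorial.fact (S n)))).
    simpl; now rewrite Rinv_1.
  - generalize (is_pseries_decr_1 (V := R_NormedModule)
                  (fun n => / INR (Factorial.fact n)) t (/ t) (exp t)).
    intros H; specialize (H (Rinv_l _ Ht) (is_exp_Reals t)).
    unfold PS_decr_1 in H.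
    match type of H with is_pseries _ _ ?v =>
      replace (/ t * (exp t - 1)) with v; [exact H|] end.
    unfold scal, plus, opp; simpl; unfold mult; simpl; rewrite Rinv_1; ring. }
apply is_pseries_incr_1 in H1.
apply (is_pseries_ext _ expm1_coef) in H1; [|now intros [|n]].
match type of H1 with is_pseries _ _ ?v =>
  replace (exp t - 1) with v; [exact H1|] end.
unfold scal; simpl; unfold mult; simpl.
destruct (Req_EM_T t 0) as [->|Ht]; [rewrite exp_0; ring|field; auto].
Qed.

Lemma is_pseries_expm1_pow n t :
  is_pseries (expm1_pow_coef n) t ((exp t - 1) ^ n).
Proof.
revert t; induction n as [|n IH]; intros t.
- apply is_pseries_R; simpl.
  apply is_series_decr_1; simpl.
  apply (is_series_ext (fun _ => 0)).
  { intros l; rewrite Rmult_0_l; reflexivity. }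
  match goal with |- is_series _ ?v => replace v with 0 end.
  + apply filterlim_ext with (fun _ => 0).
    * intros m; rewrite sum_n_const; ring.
    * apply filterlim_const.
  + unfold plus, opp; simpl; ring.
- simpl; apply is_pseries_mult; trivial using is_pseries_expm1;
    apply CV_radius_entire; intros x; eexists;
    [apply is_pseries_expm1|apply IH].
Qed.

Lemma stirling2_generating_function n t :
  is_series (fun l => INR (Factorial.fact n) * (stirling2 l n * (t ^ l / INR (Factorial.fact l))))
            ((exp t - 1) ^ n).
Proof.
generalize (proj1 (is_pseries_R _ _ _) (is_pseries_expm1_pow n t)).
apply is_series_ext; intros l; unfold stirling2; simpl.
field; split; apply INR_fact_neq_0.
Qed.

(* Main.v *)
Require Import Defs.
From Stdlib Require Import Reals Lia List.
From Coquelicot Require Import Coquelicot.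
Local Open Scope R_scope.

(** Both sides equal the integral of (x_1 + ... + x_k - x)^m over the unit cube,
    which is m! times the coefficient of t^m in ((e^t - 1)/t)^k e^(-xt).

    Left side: since S_2(n+k, k) = (n+k)!/k! [t^(n+k)] (e^t - 1)^k, dividing by
    binom(n+k, n) leaves n! [t^n] ((e^t - 1)/t)^k, and the sum over n is a
    Cauchy product with the coefficients (-x)^(m-n)/(m-n)! of e^(-xt).

    Right side: the expansion z^m = sum_n S_2(m,n) (z)_n
    ([pow_eq_sum_falling_factorial]), applied under the integral to
    z = x_1 + ... + x_k - x, turns it into the integral of z^m.

    The bridge is [is_cube_int_exp_coef]: integrating out one variable multiplies
    the generating function e^(zt) by int_0^1 e^(st) ds = (e^t - 1)/t. On
    coefficients this is the binomial formula [exp_coef_plus] followed by a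
    termwise integration, and iterating it uses only the associativity of the
    Cauchy product.

    The expansion of z^m rests on the recurrence
    S_2(m+1, n+1) = (n+1) S_2(m, n+1) + S_2(m, n), which comes from comparing
    coefficients in ((e^t - 1)^(n+1))' = (n+1) ((e^t - 1)^(n+1) + (e^t - 1)^n). *)

(** * Finite sums of complex numbers *)

(** [sum_n] types its values in the carrier of a monoid structure on [C], which
    [ring] does not recognize as [C]. *)
Ltac Cring := match goal with |- @eq _ ?a ?b => change (@eq C a b); ring end.

Lemma sum_n_Cmult_l (c : C) (u : nat -> C) n :
  sum_n (fun i => Cmult c (u i)) n = Cmult c (sum_n u n).
Proof. exact (sum_n_mult_l (K := C_Ring) c u n). Qed.

Lemma sum_n_Cmult_r (c : C) (u : nat -> C) n :
  sum_n (fun i => Cmult (u i) c) n = Cmult (sum_n u n) c.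
Proof. exact (sum_n_mult_r (K := C_Ring) c u n). Qed.

Lemma sum_n_Cplus (u v : nat -> C) n :
  sum_n (fun i => Cplus (u i) (v i)) n = Cplus (sum_n u n) (sum_n v n).
Proof. exact (sum_n_plus (G := C_Ring) u v n). Qed.

Lemma sum_n_CS (u : nat -> C) n : sum_n u (S n) = Cplus (sum_n u n) (u (S n)).
Proof. exact (sum_Sn (G := C_Ring) u n). Qed.

Lemma sum_n_C0 (u : nat -> C) : sum_n u 0 = u 0%nat.
Proof. exact (sum_O (G := C_Ring) u). Qed.

Lemma sum_n_CS_l (u : nat -> C) n :
  sum_n u (S n) = Cplus (u 0%nat) (sum_n (fun i => u (S i)) n).
Proof.
induction n as [|n IH]; [now rewrite sum_n_CS, !sum_n_C0|].
rewrite sum_n_CS, IH, (sum_n_CS (fun i => u (S i))); Cring.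
Qed.

Lemma sum_n_RtoC (u : nat -> R) n : sum_n (fun i => RtoC (u i)) n = RtoC (sum_n u n).
Proof.
induction n as [|n IH]; [rewrite sum_n_C0; f_equal; symmetry; exact (sum_O u)|].
rewrite sum_n_CS, IH, <- RtoC_plus; f_equal; symmetry.
exact (sum_Sn (G := R_AbelianGroup) u n).
Qed.

Lemma sum_n_eq_0_tail (u : nat -> C) n j :
  (forall i, (n < i <= n + j)%nat -> u i = RtoC 0) -> sum_n u (n + j) = sum_n u n.
Proof.
intros Hu; induction j as [|j IH]; [now rewrite Nat.add_0_r|].
rewrite Nat.add_succ_r, sum_n_CS, Hu, IH by (intros; try apply Hu; lia); Cring.
Qed.

(** * Cauchy products *)

Definition conv (a b : nat -> C) (n : nat) : C :=
  sum_n (fun i => Cmult (a i) (b (n - i)%nat)) n.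

Lemma conv_ext (a a' b b' : nat -> C) n :
  (forall i, a i = a' i) -> (forall i, b i = b' i) -> conv a b n = conv a' b' n.
Proof. intros Ha Hb; apply sum_n_ext; intros i; now rewrite Ha, Hb. Qed.

(** The reindexing behind the associativity of the Cauchy product. *)
Lemma sum_n_triangle (F : nat -> nat -> C) m :
  sum_n (fun n => sum_n (fun i => F i (n - i)%nat) n) m =
  sum_n (fun i => sum_n (F i) (m - i)) m.
Proof.
induction m as [|m IH]; [now rewrite !sum_n_C0|].
rewrite !sum_n_CS, IH, Nat.sub_diag, sum_n_C0, Cplus_assoc; f_equal.
rewrite <- sum_n_Cplus; apply sum_n_ext_loc; intros i Hi.
rewrite (Nat.sub_succ_l i m Hi); exact (eq_sym (sum_n_CS (F i) (m - i))).
Qed.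

Lemma conv_assoc (a b c : nat -> C) m :
  conv a (conv b c) m = conv (conv a b) c m.
Proof.
unfold conv.
transitivity (sum_n (fun i => sum_n (fun j => 
   Cmult (Cmult (a i) (b j)) (c (m - (i + j))%nat)) (m - i)) m).
- apply sum_n_ext_loc; intros i Hi.
  rewrite <- sum_n_Cmult_l; apply sum_n_ext; intros j.
  rewrite Nat.sub_add_distr; Cring.
- rewrite <- sum_n_triangle; apply sum_n_ext_loc; intros n Hn.
  rewrite <- sum_n_Cmult_r; apply sum_n_ext_loc; intros i Hi.
  do 2 f_equal; lia.
Qed.

(** The coefficient of t^n in e^(zt). *)
Definition exp_coef (z : C) (n : nat) : C :=
  Cmult (RtoC (/ INR (Factorial.fact n))) (Cpow z n).

Lemma exp_coef_S z n :
  Cmult (RtoC (INR (S n))) (exp_coef z (S n)) = Cmult z (exp_coef z n).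
Proof.
unfold exp_coef; rewrite Cpow_S.
transitivity (Cmult (RtoC (INR (S n) * / INR (Factorial.fact (S n)))) (Cmult z (Cpow z n))).
{ rewrite RtoC_mult; Cring. }
replace (INR (S n) * / INR (Factorial.fact (S n))) with (/ INR (Factorial.fact n)); [ring|].
rewrite fact_simpl, mult_INR; field; split; [apply INR_fact_neq_0|now apply not_0_INR].
Qed.

(** The binomial theorem, as the law e^((z+w)t) = e^(zt) e^(wt). As in the Leibniz
    rule for d/dt, n + 1 = i + (n + 1 - i) splits n + 1 times the Cauchy product
    into a sum with a factor z and a sum with a factor w. *)
Lemma exp_coef_plus z w n : exp_coef (Cplus z w) n = conv (exp_coef z) (exp_coef w) n.
Proof.
induction n as [|n IH].
{ unfold conv; rewrite sum_n_C0; unfold exp_coef; simpl; rewrite Rinv_1; Cring. }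
assert (Hn : RtoC (INR (S n)) <> RtoC 0).
{ intros H; apply RtoC_inj in H; revert H; now apply not_0_INR. }
enough (H : Cmult (RtoC (INR (S n))) (exp_coef (Cplus z w) (S n)) =
            Cmult (RtoC (INR (S n))) (conv (exp_coef z) (exp_coef w) (S n))).
{ apply (f_equal (Cmult (Cinv (RtoC (INR (S n)))))) in H.
  now rewrite !Cmult_assoc, Cinv_l, !Cmult_1_l in H. }
rewrite exp_coef_S, IH; unfold conv.
transitivity (Cplus
  (sum_n (fun i => Cmult (Cmult (RtoC (INR i)) (exp_coef z i)) (exp_coef w (S n - i))) (S n))
  (sum_n (fun i => Cmult (exp_coef z i)
                     (Cmult (RtoC (INR (S n - i))) (exp_coef w (S n - i)))) (S n))).
- rewrite (sum_n_CS_l (fun i => Cmult (Cmult _ _) _)).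
  rewrite (sum_n_CS (fun i => Cmult _ (Cmult _ _))), Nat.sub_diag; change (INR 0) with 0.
  rewrite !Cmult_0_l, Cmult_0_r, Cplus_0_l, Cplus_0_r.
  rewrite Cmult_plus_distr_r, <- !sum_n_Cmult_l; f_equal.
  + apply sum_n_ext; intros i; rewrite exp_coef_S; simpl Nat.sub; Cring.
  + apply sum_n_ext_loc; intros i Hi; rewrite Nat.sub_succ_l, exp_coef_S by exact Hi; Cring.
- rewrite <- sum_n_Cplus, <- sum_n_Cmult_l; apply sum_n_ext_loc; intros i Hi.
  rewrite (minus_INR _ _ Hi), RtoC_minus; Cring.
Qed.

(** The coefficient of t^i in (e^t - 1)/t. *)
Definition ratio_coef (i : nat) : C := RtoC (/ INR (Factorial.fact (S i))).

(** The coefficient of t^n in ((e^t - 1)/t)^k: dividing by t^k shifts the index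
    by k. *)
Definition ratio_pow_coef (k n : nat) : C := RtoC (expm1_pow_coef k (n + k)).

Lemma ratio_pow_coef_0 (b : nat -> C) m : conv (ratio_pow_coef 0) b m = b m.
Proof.
unfold conv, ratio_pow_coef; destruct m as [|m].
- rewrite sum_n_C0; simpl; Cring.
- rewrite sum_n_CS_l.
  rewrite (sum_n_ext _ (fun _ => Cmult (RtoC 0) (RtoC 0))).
  + rewrite sum_n_Cmult_l; simpl; Cring.
  + intros i; simpl; Cring.
Qed.

Lemma ratio_pow_coef_S k n :
  ratio_pow_coef (S k) n = conv ratio_coef (ratio_pow_coef k) n.
Proof.
unfold ratio_pow_coef, ratio_coef, conv; simpl expm1_pow_coef; unfold PS_mult.
rewrite <- sum_n_Reals, <- sum_n_RtoC, Nat.add_succ_r, sum_n_CS_l.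
simpl expm1_coef; rewrite Rmult_0_l, Cplus_0_l.
(* The series of (e^t - 1)^k starts at t^k, so the k terms beyond n vanish. *)
rewrite sum_n_eq_0_tail.
- apply sum_n_ext_loc; intros i Hi.
  rewrite RtoC_mult; do 3 f_equal; lia.
- intros i Hi; rewrite expm1_pow_coef_eq0 by lia; now rewrite Rmult_0_r.
Qed.

(** * Integration over the unit cube *)

(** Complex scalars need a proof of their own because here [C] is a normed
    module over the reals only. *)
Lemma is_RInt_Cmult_l (c : C) (f : R -> C) a b (l : C) :
  is_RInt (V := C_R_NormedModule) f a b l ->
  is_RInt (V := C_R_NormedModule) (fun t => Cmult c (f t)) a b (Cmult c l).
Proof.
intros H.
pose proof (is_RInt_fct_extend_fst _ _ _ _ H) as H1.
pose proof (is_RInt_fct_extend_snd _ _ _ _ H) as H2.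
apply (is_RInt_fct_extend_pair (U := R_NormedModule) (V := R_NormedModule)); simpl.
- now apply (is_RInt_minus (V := R_NormedModule)); apply (is_RInt_scal (V := R_NormedModule)).
- now apply (is_RInt_plus (V := R_NormedModule)); apply (is_RInt_scal (V := R_NormedModule)).
Qed.

Lemma is_RInt_sum_n (f : nat -> R -> C) a b (l : nat -> C) n :
  (forall i, is_RInt (V := C_R_NormedModule) (f i) a b (l i)) ->
  is_RInt (V := C_R_NormedModule)
    (fun t => sum_n (G := C_AbelianMonoid) (fun i => f i t) n) a b
    (sum_n (G := C_AbelianMonoid) l n).
Proof.
intros H; induction n as [|n IH].
- rewrite sum_n_C0; apply (is_RInt_ext (f 0%nat)); [|apply H].
  intros t _; now rewrite sum_n_C0.
- rewrite sum_n_CS.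
  apply (is_RInt_ext (fun t => Cplus (sum_n (fun i => f i t) n) (f (S n) t))).
  + intros t _; now rewrite sum_n_CS.
  + exact (is_RInt_plus (V := C_R_NormedModule) _ _ _ _ _ _ IH (H (S n))).
Qed.

(** int_0^1 e^(st) ds = (e^t - 1)/t, coefficient by coefficient. *)
Lemma is_RInt_exp_coef n :
  is_RInt (V := C_R_NormedModule) (fun t => exp_coef (RtoC t) n) 0 1
    (ratio_coef n).
Proof.
unfold ratio_coef.
apply (is_RInt_ext (fun t => RtoC (/ INR (Factorial.fact n) * t ^ n))).
{ intros t _; unfold exp_coef; now rewrite RtoC_mult, RtoC_pow. }
apply (is_RInt_fct_extend_pair (U := R_NormedModule) (V := R_NormedModule)); simpl fst; simpl snd.
2: { replace 0 with (scal (1 - 0) 0) at 2 by apply Rmult_0_r.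
     apply (is_RInt_const (V := R_NormedModule)). }
replace (/ INR (Factorial.fact n)) with (/ INR (Factorial.fact (S n)) * INR (S n)).
2: { rewrite fact_simpl, mult_INR; field.
     split; [apply INR_fact_neq_0|now apply not_0_INR]. }
generalize (/ INR (Factorial.fact (S n))) as c; intros c.
assert (Hc : minus (c * 1 ^ S n) (c * 0 ^ S n) = c).
{ rewrite pow1, pow_i by lia; unfold minus, plus, opp; simpl; ring. }
enough (H : is_RInt (fun t => c * INR (S n) * t ^ n) 0 1
              (minus (c * 1 ^ S n) (c * 0 ^ S n))) by now rewrite Hc in H.
clear Hc.
apply (is_RInt_derive (V := R_CompleteNormedModule) (fun t => c * t ^ S n)).
- intros t _; auto_derive; [easy|]. rewrite S_INR; destruct n; simpl; ring.
- intros t _; apply (ex_derive_continuous (V := R_NormedModule)); now auto_derive.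
Qed.

(** The relational counterpart of [unit_cube_int]: it also carries the
    integrability of every partial integral, and so is linear in [f] without
    side conditions. *)
Fixpoint is_cube_int (k : nat) (f : list R -> C) (v : C) : Prop :=
  match k with
  | O => f nil = v
  | S p => exists g : list R -> C,
      (forall xs, is_RInt (V := C_R_NormedModule) (fun t => f (t :: xs)) 0 1 (g xs)) /\
      is_cube_int p g v
  end.

Lemma is_cube_int_ext k (f g : list R -> C) v :
  (forall xs, f xs = g xs) -> is_cube_int k f v -> is_cube_int k g v.
Proof.
destruct k as [|k]; intros Hfg; simpl; [now rewrite Hfg|].
intros [h [Hh Hv]]; exists h; split; [|exact Hv].
intros xs; apply (is_RInt_ext (fun t => f (t :: xs))); [intros; apply Hfg|apply Hh].
Qed.

Lemma is_cube_int_unique k f v : is_cube_int k f v -> unit_cube_int k f = v.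
Proof.
revert f; induction k as [|k IH]; intros f; [easy|].
intros [g [Hg Hv]]; apply IH; apply (is_cube_int_ext k g); [|exact Hv].
intros xs; symmetry; exact (is_RInt_unique (V := C_R_CompleteNormedModule) _ _ _ _ (Hg xs)).
Qed.

Lemma is_cube_int_plus k f g v w :
  is_cube_int k f v -> is_cube_int k g w ->
  is_cube_int k (fun xs => Cplus (f xs) (g xs)) (Cplus v w).
Proof.
revert f g; induction k as [|k IH]; intros f g; simpl; [now intros -> ->|].
intros [f' [Hf Hv]] [g' [Hg Hw]]; exists (fun xs => Cplus (f' xs) (g' xs)); split; [|now apply IH].
intros xs; exact (is_RInt_plus (V := C_R_NormedModule) _ _ _ _ _ _ (Hf xs) (Hg xs)).
Qed.

Lemma is_cube_int_Cmult_l k c f v :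
  is_cube_int k f v -> is_cube_int k (fun xs => Cmult c (f xs)) (Cmult c v).
Proof.
revert f; induction k as [|k IH]; intros f; simpl; [now intros ->|].
intros [f' [Hf Hv]]; exists (fun xs => Cmult c (f' xs)); split; [|now apply IH].
intros xs; now apply is_RInt_Cmult_l.
Qed.

Lemma is_cube_int_sum_n k (f : nat -> list R -> C) (v : nat -> C) n :
  (forall i, is_cube_int k (f i) (v i)) ->
  is_cube_int k (fun xs => sum_n (fun i => f i xs) n) (sum_n v n).
Proof.
intros H; induction n as [|n IH].
- rewrite sum_n_C0; apply (is_cube_int_ext k (f 0%nat)); [|apply H].
  intros xs; now rewrite sum_n_C0.
- rewrite sum_n_CS.
  apply (is_cube_int_ext k (fun xs => Cplus (sum_n (fun i => f i xs) n) (f (S n) xs))).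
  + intros xs; now rewrite sum_n_CS.
  + now apply is_cube_int_plus.
Qed.

(** Integrating the innermost variable out of a coefficient of
    e^((x_1 + ... + x_k + y) t) leaves a combination of coefficients of the same
    kind in k - 1 variables, weighted by [ratio_coef]; so each of the k steps
    contributes one factor (e^t - 1)/t. *)
Lemma is_cube_int_exp_coef k m y :
  is_cube_int k (fun xs => exp_coef (Cplus (RtoC (list_sum_R xs)) y) m)
    (conv (ratio_pow_coef k) (exp_coef y) m).
Proof.
revert m; induction k as [|k IH]; intros m; simpl is_cube_int.
- rewrite ratio_pow_coef_0; simpl; now rewrite Cplus_0_l.
- exists (fun xs => conv ratio_coef
                      (exp_coef (Cplus (RtoC (list_sum_R xs)) y)) m); split.
  + intros xs.
    apply (is_RInt_ext (fun t => sum_n (G := C_AbelianMonoid) (fun i =>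
      Cmult (exp_coef (Cplus (RtoC (list_sum_R xs)) y) (m - i)) (exp_coef (RtoC t) i)) m)).
    { intros t _; simpl; rewrite RtoC_plus, <- Cplus_assoc, exp_coef_plus.
      apply (sum_n_ext (G := C_AbelianMonoid)); intros i; apply Cmult_comm. }
    unfold conv; rewrite (sum_n_ext _ (fun i =>
      Cmult (exp_coef (Cplus (RtoC (list_sum_R xs)) y) (m - i))
      (ratio_coef i))) by (intros i; apply Cmult_comm).
    apply (is_RInt_sum_n (fun i t =>
      Cmult (exp_coef (Cplus (RtoC (list_sum_R xs)) y) (m - i)) (exp_coef (RtoC t) i))).
    intros i; apply is_RInt_Cmult_l, is_RInt_exp_coef.
  + rewrite (conv_ext _ _ _ _ m (ratio_pow_coef_S k) (fun i => eq_refl)), <- conv_assoc.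
    apply (is_cube_int_sum_n k (fun i xs => Cmult (ratio_coef i)
             (exp_coef (Cplus (RtoC (list_sum_R xs)) y) (m - i)))).
    intros i; now apply is_cube_int_Cmult_l.
Qed.

Lemma is_cube_int_pow k m y :
  is_cube_int k (fun xs => Cpow (Cplus (RtoC (list_sum_R xs)) y) m)
    (Cmult (RtoC (INR (Factorial.fact m))) (conv (ratio_pow_coef k) (exp_coef y) m)).
Proof.
apply (is_cube_int_ext k (fun xs => Cmult (RtoC (INR (Factorial.fact m)))
         (exp_coef (Cplus (RtoC (list_sum_R xs)) y) m))).
- intros xs; unfold exp_coef; rewrite Cmult_assoc, <- RtoC_mult, Rinv_r by apply INR_fact_neq_0.
  apply Cmult_1_l.
- apply is_cube_int_Cmult_l, is_cube_int_exp_coef.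
Qed.

(** Integrability of the falling factorial. The extra factor z^j makes the
    induction go through without expanding (z)_n into powers:
    (z)_(n+1) z^j = (z)_n z^(j+1) - n (z)_n z^j. *)
Lemma cube_int_falling_factorial_pow k y n j : exists v : C,
  is_cube_int k (fun xs => let z := Cplus (RtoC (list_sum_R xs)) y in
     Cmult (falling_factorial z n) (Cpow z j)) v.
Proof.
revert j; induction n as [|n IH]; intros j.
- eexists; eapply is_cube_int_ext; [|apply (is_cube_int_pow k j y)].
  intros xs; simpl; now rewrite Cmult_1_l.
- destruct (IH (S j)) as [v Hv], (IH j) as [w Hw].
  eexists; eapply is_cube_int_ext;
    [|exact (is_cube_int_plus _ _ _ _ _ Hv (is_cube_int_Cmult_l _ (RtoC (- INR n)) _ _ Hw))].
  intros xs; simpl; rewrite RtoC_opp; ring.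
Qed.

Lemma is_cube_int_falling_factorial k n x :
  is_cube_int k (fun xs => falling_factorial (Cminus (RtoC (list_sum_R xs)) x) n)
    (cauchy_poly k n x).
Proof.
destruct (cube_int_falling_factorial_pow k (Copp x) n 0) as [v Hv].
assert (H : is_cube_int k
  (fun xs => falling_factorial (Cminus (RtoC (list_sum_R xs)) x) n) v).
{ eapply is_cube_int_ext; [|exact Hv]; intros xs; apply Cmult_1_r. }
unfold cauchy_poly; now rewrite (is_cube_int_unique _ _ _ H).
Qed.

(** * Powers as sums of falling factorials *)

(** Comparison of coefficients in
    ((e^t - 1)^(n+1))' = (n+1) (e^t - 1)^n e^t with e^t = (e^t - 1) + 1; both
    sides are sums of everywhere convergent power series. *)
Lemma expm1_pow_coef_SS n l :
  INR (S l) * expm1_pow_coef (S n) (S l) =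
  INR (S n) * (expm1_pow_coef (S n) l + expm1_pow_coef n l).
Proof.
assert (Hr : forall p t, Rbar_lt (Rabs t) (CV_radius (expm1_pow_coef p))).
{ intros p t; apply CV_radius_entire; intros u; eexists; apply is_pseries_expm1_pow. }
set (b := PS_scal (INR (S n)) (PS_plus (expm1_pow_coef (S n)) (expm1_pow_coef n))).
assert (Hb : forall t, is_pseries b t (INR (S n) * ((exp t - 1) ^ S n + (exp t - 1) ^ n))).
{ intros t; apply (is_pseries_scal (V := R_NormedModule)); [apply Rmult_comm|].
  apply (is_pseries_plus (V := R_NormedModule)); apply is_pseries_expm1_pow. }
apply (PSeries_ext_recip (PS_derive (expm1_pow_coef (S n))) b l).
- rewrite CV_radius_derive; generalize (Hr (S n) 0); now rewrite Rabs_R0.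
- replace (Finite 0) with (Finite (Rabs 0)) by now rewrite Rabs_R0.
  apply CV_radius_entire; intros t; eexists; apply Hb.
- refine (filter_forall _ (fun t : R => _)).
  rewrite (is_pseries_unique _ _ _ (Hb t)), <- Derive_PSeries by apply Hr.
  rewrite (Derive_ext _ (fun u => (exp u - 1) ^ S n)).
  + apply is_derive_unique; auto_derive; [easy|].
    change (exp t + - (1)) with (exp t - 1).
    rewrite S_INR; destruct n; simpl; ring.
  + intros u; apply is_pseries_unique, is_pseries_expm1_pow.
Qed.

Lemma stirling2_SS m n :
  stirling2 (S m) (S n) = INR (S n) * stirling2 m (S n) + stirling2 m n.
Proof.
unfold stirling2; rewrite !fact_simpl, !mult_INR.
replace (INR (S m) * INR (Factorial.fact m) / (INR (S n) * INR (Factorial.fact n)) *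
         expm1_pow_coef (S n) (S m))
  with (INR (Factorial.fact m) / (INR (S n) * INR (Factorial.fact n)) *
        (INR (S m) * expm1_pow_coef (S n) (S m)))
  by (field; split; [apply INR_fact_neq_0|now apply not_0_INR]).
rewrite expm1_pow_coef_SS; field; split; [apply INR_fact_neq_0|now apply not_0_INR].
Qed.

Lemma stirling2_S0 m : stirling2 (S m) 0 = 0.
Proof. unfold stirling2; simpl expm1_pow_coef; ring. Qed.

(** Induction on m: z (z)_n = (z)_(n+1) + n (z)_n matches the recurrence of
    [stirling2_SS]. *)
Lemma pow_eq_sum_falling_factorial z m :
  Cpow z m = sum_n (fun n => Cmult (falling_factorial z n) (RtoC (stirling2 m n))) m.
Proof.
induction m as [|m IH].
- rewrite sum_n_C0; unfold stirling2; simpl.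
  replace (1 / 1 * 1) with 1 by field; Cring.
- rewrite Cpow_S, IH, sum_n_CS_l, stirling2_S0, Cmult_0_r, Cplus_0_l, <- sum_n_Cmult_l.
  transitivity (Cplus
    (sum_n (fun n => Cmult (RtoC (INR n))
              (Cmult (falling_factorial z n) (RtoC (stirling2 m n)))) (S m))
    (sum_n (fun n => Cmult (falling_factorial z (S n)) (RtoC (stirling2 m n))) m)).
  + rewrite sum_n_CS, (stirling2_eq0 m (S m)) by lia.
    rewrite !Cmult_0_r, Cplus_0_r, <- sum_n_Cplus.
    apply sum_n_ext; intros n; simpl; Cring.
  + rewrite sum_n_CS_l; change (INR 0) with 0.
    rewrite Cmult_0_l, Cplus_0_l, <- sum_n_Cplus.
    apply sum_n_ext; intros n; rewrite stirling2_SS, RtoC_plus, RtoC_mult; Cring.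
Qed.

(** * The identity *)

Theorem theorem2p5 : forall (m k : nat) (x : C), (1 <= k)%nat ->
  sum_n (fun n : nat =>
    (RtoC (Binomial.C m n / Binomial.C (n + k) n * stirling2 (n + k) k)
     * (- x) ^ (m - n))%C) m
  = sum_n (fun n : nat =>
    (cauchy_poly k n x * RtoC (stirling2 m n))%C) m.
Proof.
intros m k x _.
(* The common value is the integral of (x_1 + ... + x_k - x)^m. *)
transitivity (Cmult (RtoC (INR (Factorial.fact m)))
                (conv (ratio_pow_coef k) (exp_coef (Copp x)) m)).
- unfold conv; rewrite <- sum_n_Cmult_l; apply sum_n_ext_loc; intros n Hn.
  unfold ratio_pow_coef, exp_coef.
  rewrite !Cmult_assoc, <- !RtoC_mult; do 2 f_equal.
  unfold Binomial.C, stirling2; replace (n + k - n)%nat with k by lia.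
  field; repeat split; apply INR_fact_neq_0.
- rewrite <- (is_cube_int_unique _ _ _ (is_cube_int_pow k m (Copp x))).
  apply is_cube_int_unique.
  apply (is_cube_int_ext k (fun xs => sum_n (fun n => Cmult (RtoC (stirling2 m n))
           (falling_factorial (Cminus (RtoC (list_sum_R xs)) x) n)) m)).
  + intros xs.
    change (Cplus (RtoC (list_sum_R xs)) (Copp x)) with (Cminus (RtoC (list_sum_R xs)) x).
    rewrite pow_eq_sum_falling_factorial; apply sum_n_ext; intros n; apply Cmult_comm.
  + rewrite (sum_n_ext _ (fun n => Cmult (RtoC (stirling2 m n)) (cauchy_poly k n x)))
      by (intros n; apply Cmult_comm).
    apply (is_cube_int_sum_n k (fun n xs => Cmult (RtoC (stirling2 m n))
             (falling_factorial (Cminus (RtoC (list_sum_R xs)) x) n))).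
    intros n; apply is_cube_int_Cmult_l, is_cube_int_falling_factorial.
Qed.
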